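(* Consider the distributed state feedback problem $$\inf_{K(\lambda)\in S_{\mathcal{A}}^{m\times n}}\ \lim_{M\to\infty}\frac1M\sum_{t=1}^M\sum_{i=1}^N\mathbf{E}\|z_i(t)\|^2\quad\text{subject to } x(t+1)=Ax(t)+Bu(t)+w(t),\ z(t)=Cx(t)+Du(t),\ u(t)=\sum_{s=0}^\infty k(s)x(t-s),$$ where $K(\lambda)=\sum_{s\ge0}k(s)\lambda^s$, and the distributed feedforward problem $$\inf_{G(\lambda)\in S_{\mathcal{A}}^{m\times n}}\ \lim_{M\to\infty}\frac1M\sum_{t=1}^M\sum_{i=1}^N\mathbf{E}\|z_i(t)\|^2\quad\text{subject to } x(t+1)=Ax(t)+Bu(t)+w(t),\ z(t)=Cx(t)+Du(t),\ u(t)=-\sum_{s=0}^\infty g(s)w(t-1-s),$$ where $G(\lambda)=\sum_{s\ge0}g(s)\lambda^s$. In both problems the data $A,B,C,D,\mathcal{A}$ and the disturbance $w$ are the same. Then the two problems are in bijection: there is a bijection between the controllers $K(\lambda)\in S_{\mathcal{A}}^{m\times n}$ of the first problem and the controllers $G(\lambda)\in S_{\mathcal{A}}^{m\times n}$ of the second problem such that corresponding controllers $K$ and $G$ generate, from the same disturbance $w$, the same control signal $u$ (and therefore the same $x$ and $z$, hence the same cost).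
   Context: Setting: $N$ interconnected systems, with dimensions $n=\sum_{i=1}^N n_i$ and $m=\sum_{i=1}^N m_i$ (all $n_i,m_i\geq 1$). The state is $x(t)=(x_1(t),\dots,x_N(t))$ with $x_i(t)\in\mathbb{R}^{n_i}$, the control is $u(t)=(u_1(t),\dots,u_N(t))$ with $u_i(t)\in\mathbb{R}^{m_i}$. The matrix $A\in\mathbb{R}^{n\times n}$ has blocks $A_{ij}\in\mathbb{R}^{n_i\times n_j}$; $B=\mathrm{diag}(B_{11},\dots,B_{NN})\in\mathbb{R}^{n\times m}$ is block diagonal with $B_{ii}\in\mathbb{R}^{n_i\times m_i}$ of full column rank; $C$ and $D$ are real matrices of compatible dimensions with $n$ and $m$ columns respectively, and $z(t)$ is partitioned into blocks $z_1(t),\dots,z_N(t)$. The disturbance satisfies $w(t)=0$ for $t<0$, and $w(t)\sim\mathcal{N}(0,I)$ for $t\ge0$ with $w(t)$, $t\ge 0$, mutually uncorrelated; $x(t)=0$ for all $t\le 0$. $\mathcal{A}\in\{0,1\}^{N\times N}$ is the adjacency matrix of the interconnection graph: for $i\ne j$, $\mathcal{A}_{ij}=1$ if $A_{ij}\neq0$ and $\mathcal{A}_{ij}=0$ if $A_{ij}=0$; every node has one loop, so $\mathcal{A}_{ii}=1$ for all $i$. The powers $\mathcal{A}^t$ ($\mathcal{A}^0=I$) are computed over the non-negative integers (not modulo 2). For an $m\times n$ matrix $M$, $[M]_{ij}\in\mathbb{R}^{m_i\times n_j}$ denotes its $(i,j)$ block. The sparsity structure given by $\mathcal{A}$ is the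 set of formal power series $$S_{\mathcal{A}}^{m\times n}=\Big\{\sum_{t\ge 0}g(t)\lambda^t \;:\; g(t)\in\mathbb{R}^{m\times n},\ [\mathcal{A}^t]_{ij}=0\Rightarrow [g(t)]_{ij}=0 \text{ for all } t\ge 0 \text{ and all } i,j\Big\}.$$ *)

(* Defs.v *)
(* MathComp / MathComp-Analysis. *)
From HB Require Import structures.
From mathcomp Require Import all_boot all_order all_algebra.
From mathcomp Require Import all_classical all_reals all_analysis.

Set Implicit Arguments.
Unset Strict Implicit.
Unset Printing Implicit Defensive.

Import Order.TTheory GRing.Theory Num.Theory.
Import numFieldNormedType.Exports.

Local Open Scope classical_set_scope.
Local Open Scope ring_scope.

(* Powers of this matrix are powers in the semiring 'M[nat]_N, i.e. they
   count walks. *)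
Definition adjacency (R : realType) (N : nat) (n_ : 'I_N -> nat)
    (A : 'M[R]_(\sum_i n_ i)) : 'M[nat]_N :=
  \matrix_(i, j) (if (i == j) || (submxblock A i j != 0) then 1%N else 0%N).

Definition block_diagonal (R : realType) (N : nat) (n_ m_ : 'I_N -> nat)
    (B : 'M[R]_(\sum_i n_ i, \sum_i m_ i)) : Prop :=
  forall i j, i != j -> submxblock B i j = 0.

(* The formal power series \sum_(t >= 0) g(t) lambda^t is represented by its
   sequence of coefficients g. *)
Definition power_series (R : realType) (m n : nat) := nat -> 'M[R]_(m, n).

Definition sparse_series (R : realType) (N : nat) (m_ n_ : 'I_N -> nat)
    (Adj : 'M[nat]_N) : set (power_series R (\sum_i m_ i) (\sum_i n_ i)) :=
  [set g | forall (t : nat) i j,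
     (Adj ^+ t) i j = 0%N -> submxblock (g t) i j = 0].

(* Vector-valued stochastic processes over a sample space T, with integer
   time. *)
Definition process (R : realType) (T : Type) (q : nat) := int -> T -> 'cV[R]_q.

(* X ~ N(0, I): the law of X is the product of q standard normal laws. *)
Definition standard_gaussian (R : realType) (d : measure_display)
    (T : measurableType d) (P : probability T R) (q : nat)
    (X : T -> 'cV[R]_q) : Prop :=
  (forall i, measurable_fun [set: T] (fun om => X om i 0)) /\
  forall V : 'I_q -> set R, (forall i, measurable (V i)) ->
    P [set om | forall i, V i (X om i 0)] =
      (\prod_(i < q) normal_prob 0 1 (V i))%E.

Definition uncorrelated (R : realType) (d : measure_display)
    (T : measurableType d) (P : probability T R) (q : nat)
    (X Y : T -> 'cV[R]_q) : Prop :=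
  forall i j, covariance P (fun om => X om i 0) (fun om => Y om j 0) = 0%E.

Definition disturbance (R : realType) (d : measure_display)
    (T : measurableType d) (P : probability T R) (q : nat)
    (w : process R T q) : Prop :=
  [/\ forall (t : int) om, t < 0 -> w t om = 0,
      forall t : int, 0 <= t -> standard_gaussian P (w t)
    & forall s t : int, 0 <= s -> 0 <= t -> s != t ->
        uncorrelated P (w s) (w t)].

Record signals (R : realType) (T : Type) (n m p : nat) := Signals {
  state : process R T n;
  control : process R T m;
  output : process R T p }.

Definition plant (R : realType) (T : Type) (n m p : nat)
    (A : 'M[R]_n) (B : 'M[R]_(n, m)) (C : 'M[R]_(p, n)) (D : 'M[R]_(p, m))
    (w : process R T n) (s : signals R T n m p) : Prop :=
  [/\ forall (t : int) om, t <= 0 -> state s t om = 0,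
      forall (t : int) om,
        state s (t + 1) om = A *m state s t om + B *m control s t om + w t om
    & forall (t : int) om,
        output s t om = C *m state s t om + D *m control s t om].

Definition feedback_signals (R : realType) (T : Type) (n m p : nat)
    (A : 'M[R]_n) (B : 'M[R]_(n, m)) (C : 'M[R]_(p, n)) (D : 'M[R]_(p, m))
    (w : process R T n) (K : power_series R m n)
    (s : signals R T n m p) : Prop :=
  plant A B C D w s /\
  forall (t : int) om,
    series (fun j : nat => K j *m state s (t - j%:Z) om) @ \oo
      --> control s t om.

Definition feedforward_signals (R : realType) (T : Type) (n m p : nat)
    (A : 'M[R]_n) (B : 'M[R]_(n, m)) (C : 'M[R]_(p, n)) (D : 'M[R]_(p, m))
    (w : process R T n) (G : power_series R m n)
    (s : signals R T n m p) : Prop :=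
  plant A B C D w s /\
  forall (t : int) om,
    (fun M : nat => - series (fun j : nat => G j *m w (t - 1 - j%:Z) om) M)
      @ \oo --> control s t om.

(* The squared Euclidean norm; the norm of the library on matrices is the
   sup norm. *)
Definition sqnorm2 (R : realType) (q : nat) (v : 'cV[R]_q) : R :=
  \sum_(i < q) v i 0 ^+ 2.

(* For a disturbance w as above, E |z(t)|^2 is nondecreasing in t along the
   signals of either problem, so that this limit always exists in \bar R. *)
Definition cost (R : realType) (d : measure_display) (T : measurableType d)
    (P : probability T R) (N : nat) (p_ : 'I_N -> nat)
    (z : process R T (\sum_i p_ i)) : \bar R :=
  limn (fun M : nat => ((M%:R^-1)%:E *
    \sum_(1 <= t < M.+1) \sum_(i < N)
      'E_P[fun om => sqnorm2 (submxcol (z t%:Z om) i)])%E).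

(* The infimum of the cost over the controllers in S, for a problem given by
   the relation between a controller and the signals that it generates. *)
Definition optimal_value (R : realType) (d : measure_display)
    (T : measurableType d) (P : probability T R) (n m N : nat)
    (p_ : 'I_N -> nat) (S : set (power_series R m n))
    (problem : power_series R m n -> signals R T n m (\sum_i p_ i) -> Prop) :
    \bar R :=
  ereal_inf [set J | exists K s,
    [/\ S K, problem K s & J = cost P (output s)]].

(* Main.v *)
Require Import Defs.
From mathcomp Require Import all_boot all_order all_algebra.
From mathcomp Require Import all_classical all_reals all_analysis.
Import Order.TTheory GRing.Theory Num.Theory.
Import numFieldNormedType.Exports.
Local Open Scope classical_set_scope.
Local Open Scope ring_scope.

(** In terms of generating series in the delay [lambda], the plant reads
    [x = lambda (A x + B u + w)], with all signals supported on nonnegative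
    times. Feedback [u = K x] gives
    [x = (1 - lambda (A + B K))^-1 lambda w], hence [u = - lambda G w] for
    [G = - K (1 - lambda (A + B K))^-1]. Conversely,
    [K = - G (1 - lambda B G)^-1 (1 - lambda A)]. Because every node has a
    loop, the zero pattern of [Adj ^+ t] shrinks as [t] grows, so that
    [lambda A], [lambda B K] and [lambda B G] are sparse; sparse series are
    closed under products and under [Q |-> (1 - lambda Q)^-1], so both maps
    preserve sparsity. *)

(** * Matrix power series *)

Section PowerSeries.
Context {R : pzRingType}.

Definition conv {m n p} (f : nat -> 'M[R]_(m, n)) (g : nat -> 'M[R]_(n, p)) :
    nat -> 'M[R]_(m, p) :=
  fun t => \sum_(i < t.+1) f i *m g (t - i)%N.

Definition shift {m n} (f : nat -> 'M[R]_(m, n)) : nat -> 'M[R]_(m, n) :=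
  fun t => if t is s.+1 then f s else 0.

Definition const_series {m n} (M : 'M[R]_(m, n)) : nat -> 'M[R]_(m, n) :=
  fun t => if t is 0%N then M else 0.

Definition one_series n : nat -> 'M[R]_n := const_series 1%:M.

Lemma series_addE {m n} (f g : nat -> 'M[R]_(m, n)) t :
  (f + g) t = f t + g t.
Proof. by []. Qed.

Lemma convS {m n p} (f : nat -> 'M[R]_(m, n)) (g : nat -> 'M[R]_(n, p)) t :
  conv f g t.+1 = f 0%N *m g t.+1 + conv (fun s => f s.+1) g t.
Proof. by rewrite /conv big_ord_recl subn0. Qed.

Lemma convDl {m n p} (f f' : nat -> 'M[R]_(m, n)) (g : nat -> 'M[R]_(n, p)) :
  conv (f + f') g = conv f g + conv f' g.
Proof.
apply/funext => t; rewrite series_addE /conv -big_split/=.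
by apply: eq_bigr => i _; rewrite -mulmxDl.
Qed.

Lemma convDr {m n p} (f : nat -> 'M[R]_(m, n)) (g g' : nat -> 'M[R]_(n, p)) :
  conv f (g + g') = conv f g + conv f g'.
Proof.
apply/funext => t; rewrite series_addE /conv -big_split/=.
by apply: eq_bigr => i _; rewrite -mulmxDr.
Qed.

Lemma convNl {m n p} (f : nat -> 'M[R]_(m, n)) (g : nat -> 'M[R]_(n, p)) :
  conv (- f) g = - conv f g.
Proof.
apply/funext => t; rewrite [RHS]/GRing.opp/= /conv -sumrN.
by apply: eq_bigr => i _; rewrite -mulNmx.
Qed.

Lemma convNr {m n p} (f : nat -> 'M[R]_(m, n)) (g : nat -> 'M[R]_(n, p)) :
  conv f (- g) = - conv f g.
Proof.
apply/funext => t; rewrite [RHS]/GRing.opp/= /conv -sumrN.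
by apply: eq_bigr => i _; rewrite -mulmxN.
Qed.

Lemma convBl {m n p} (f f' : nat -> 'M[R]_(m, n)) (g : nat -> 'M[R]_(n, p)) :
  conv (f - f') g = conv f g - conv f' g.
Proof. by rewrite convDl convNl. Qed.

Lemma convBr {m n p} (f : nat -> 'M[R]_(m, n)) (g g' : nat -> 'M[R]_(n, p)) :
  conv f (g - g') = conv f g - conv f g'.
Proof. by rewrite convDr convNr. Qed.

Lemma conv_const {m n p} (M : 'M[R]_(m, n)) (g : nat -> 'M[R]_(n, p)) t :
  conv (const_series M) g t = M *m g t.
Proof.
by rewrite /conv big_ord_recl subn0 big1 ?addr0// => i _; rewrite mul0mx.
Qed.

Lemma conv1l {m n} (f : nat -> 'M[R]_(m, n)) : conv (one_series m) f = f.
Proof. by apply/funext => t; rewrite conv_const mul1mx. Qed.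

Lemma conv1r {m n} (f : nat -> 'M[R]_(m, n)) : conv f (one_series n) = f.
Proof.
apply/funext => t; rewrite /conv big_ord_recr/= subnn/= mulmx1 big1 ?add0r//.
by move=> i _; move: (ltn_ord i); rewrite -subn_gt0; case: subn => // k;
  rewrite mulmx0.
Qed.

Lemma convA {m n p q} (f : nat -> 'M[R]_(m, n)) (g : nat -> 'M[R]_(n, p))
    (h : nat -> 'M[R]_(p, q)) :
  conv (conv f g) h = conv f (conv g h).
Proof.
apply/funext => t; elim: t f g => [|t IH] f g.
  by rewrite /conv !big_ord_recl !big_ord0 !addr0 mulmxA.
(* Peeling off constant terms: the tail of [conv f g] is [f 0] times the tail of [g] plus the tail
   of [f] times [g], and [IH] covers both products. *)
have -> : conv (conv f g) h t.+1 = f 0%N *m g 0%N *m h t.+1 +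
    conv (conv (const_series (f 0%N)) (fun s => g s.+1) +
          conv (fun s => f s.+1) g) h t.
  rewrite convS; congr (_ *m _ + _).
    by rewrite /conv big_ord_recl big_ord0 addr0.
  congr conv; apply/funext => s.
  by rewrite convS series_addE conv_const.
by rewrite convDl series_addE IH conv_const IH !convS mulmxDr mulmxA
  addrA.
Qed.

Lemma shiftD {m n} (f g : nat -> 'M[R]_(m, n)) :
  shift (f + g) = shift f + shift g.
Proof. by apply/funext => -[|t] //; rewrite series_addE addr0. Qed.

Lemma shiftN {m n} (f : nat -> 'M[R]_(m, n)) : shift (- f) = - shift f.
Proof. by apply/funext => -[|t] //; exact/esym/oppr0. Qed.

Lemma conv_shiftl {m n p} (f : nat -> 'M[R]_(m, n)) (g : nat -> 'M[R]_(n, p)) :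
  conv (shift f) g = shift (conv f g).
Proof.
apply/funext => -[|t].
  by rewrite /conv big_ord_recl big_ord0 mul0mx addr0.
by rewrite convS mul0mx add0r.
Qed.

(** * The inverse of [1 - lambda Q] *)

Section Inverse.
Context {n : nat}.
Implicit Types Q : nat -> 'M[R]_n.

Definition one_minus_shift Q : nat -> 'M[R]_n := one_series n - shift Q.

(* The iterates [h_k] of [h |-> 1 + lambda Q h] agree with the inverse of
   [1 - lambda Q] up to degree [k - 1]. *)
Definition geometric Q : nat -> 'M[R]_n :=
  fun t => iter t.+1 (fun h => one_series n + shift (conv Q h)) 0 t.

(** Coefficient [t] of [F h] involves only coefficients of [h] below [t], so coefficient [t] of the
    iterates is fixed from step [t + 1] on. *)
Lemma geometricE Q :
  geometric Q = one_series n + shift (conv Q (geometric Q)).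
Proof.
pose F h := one_series n + shift (conv Q h).
have F_causal h h' t : (forall s, (s < t)%N -> h s = h' s) -> F h t = F h' t.
  move=> hh'; rewrite /F !series_addE; congr (_ + _).
  case: t hh' => //= t hh'.
  by apply: eq_bigr => i _; rewrite hh'// ltnS leq_subr.
have iter_stable s k l : (s < k)%N -> (s < l)%N -> iter k F 0 s = iter l F 0 s.
  elim: k l s => [|k IH] [|l] s // sk sl; apply: F_causal => r rs.
  by apply: IH; exact: leq_trans rs _.
(* Coefficient [t] of [geometric Q] unfolds to that of [F] applied to the [t]-th iterate, which
   agrees with [geometric Q] below degree [t]. *)
apply/funext => t; apply: (F_causal _ (geometric Q)) => s st.
exact: iter_stable.
Qed.

(** The delay expresses each coefficient of [f] through strictly earlier ones, so all vanish by
    strong induction. *)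
Lemma shift_conv_fixpoint {p} Q (f : nat -> 'M[R]_(n, p)) :
  f = shift (conv Q f) -> f = 0.
Proof.
move=> fE; apply/funext => t; elim: t {-2}t (leqnn t) => [|b IH] t tb.
  by move: tb; rewrite leqn0 => /eqP ->; rewrite fE.
rewrite fE; case: t tb => //= t tb; rewrite /conv big1// => i _.
by rewrite IH ?mulmx0// (leq_trans (leq_subr _ _)).
Qed.

Lemma conv_one_minus_shift {p} Q (f : nat -> 'M[R]_(n, p)) :
  conv (one_minus_shift Q) f = f - shift (conv Q f).
Proof. by rewrite convBl conv1l conv_shiftl. Qed.

Lemma conv_one_minus_shift_inj {p} Q (f g : nat -> 'M[R]_(n, p)) :
  conv (one_minus_shift Q) f = conv (one_minus_shift Q) g -> f = g.
Proof.
move=> /eqP; rewrite -subr_eq0 -convBr conv_one_minus_shift subr_eq0 => /eqP.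
by move=> /shift_conv_fixpoint/eqP; rewrite subr_eq0 => /eqP.
Qed.

Lemma mul_geometric Q :
  conv (one_minus_shift Q) (geometric Q) = one_series n.
Proof. by rewrite conv_one_minus_shift {1}geometricE addrK. Qed.

(** [1 - lambda Q] cancels on the left, so its right inverse is also a left inverse. *)
Lemma geometric_mul Q :
  conv (geometric Q) (one_minus_shift Q) = one_series n.
Proof.
apply: (conv_one_minus_shift_inj Q).
by rewrite -convA mul_geometric conv1l conv1r.
Qed.

Lemma geometric_solve {p} Q (f g : nat -> 'M[R]_(n, p)) :
  f = shift (conv Q f) + g <-> f = conv (geometric Q) g.
Proof.
split=> [fE|->].
  have <- : conv (one_minus_shift Q) f = g.
    by rewrite conv_one_minus_shift {1}fE addrAC subrr add0r.
  by rewrite -convA geometric_mul conv1l.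
by rewrite {1}geometricE convDl conv1l conv_shiftl convA addrC.
Qed.

End Inverse.
End PowerSeries.

(** * The correspondence between the controllers *)

Section Controllers.
Context {R : pzRingType} {n m : nat} (A : 'M[R]_n) (B : 'M[R]_(n, m)).
Implicit Types K G : nat -> 'M[R]_(m, n).

Definition closed_loop K : nat -> 'M[R]_n :=
  const_series A + conv (const_series B) K.

Definition to_feedforward K : nat -> 'M[R]_(m, n) :=
  - conv K (geometric (closed_loop K)).

Definition to_feedback G : nat -> 'M[R]_(m, n) :=
  - conv (conv G (geometric (conv (const_series B) G)))
         (one_minus_shift (const_series A)).

Let cA : nat -> 'M[R]_n := const_series A.
Let cB : nat -> 'M[R]_(n, m) := const_series B.

Lemma one_minus_closed_loop K :
  one_minus_shift (closed_loop K) = one_minus_shift cA - shift (conv cB K).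
Proof. by rewrite /one_minus_shift shiftD opprD addrA. Qed.

(** With [H] the inverse of [1 - lambda (A + B K)], both sides equal [1 + lambda B K H]. *)
Lemma one_minus_to_feedforward K :
  one_minus_shift (conv cB (to_feedforward K)) =
  conv (one_minus_shift cA) (geometric (closed_loop K)).
Proof.
have -> : one_minus_shift cA =
    one_minus_shift (closed_loop K) + shift (conv cB K).
  by rewrite one_minus_closed_loop subrK.
rewrite convDl mul_geometric conv_shiftl convA.
by rewrite /one_minus_shift convNr shiftN opprK.
Qed.

(** With [L] the inverse of [1 - lambda B G], the left side is [(1 + lambda B G L) (1 - lambda A)],
    and [1 + lambda B G L = L] is the fixed-point equation of [L]. *)
Lemma one_minus_to_feedback G :
  one_minus_shift (closed_loop (to_feedback G)) =
  conv (geometric (conv cB G)) (one_minus_shift cA).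
Proof.
rewrite one_minus_closed_loop convNr shiftN opprK -!convA -conv_shiftl.
by rewrite {2}geometricE convDl conv1l.
Qed.

Lemma to_feedforwardK : cancel to_feedforward to_feedback.
Proof.
move=> K; set H := geometric (closed_loop K).
(* For the image [G] of [K], [1 - lambda B G = (1 - lambda A) H]; inverting this reverses the
   factors, and [H] cancels. *)
have HF : conv H (geometric (conv cB (to_feedforward K))) = geometric cA.
  apply: (conv_one_minus_shift_inj cA).
  by rewrite -convA -one_minus_to_feedforward !mul_geometric.
rewrite /to_feedback {1}/to_feedforward -/H !convNl opprK.
by rewrite [conv (conv K H) _]convA HF convA geometric_mul conv1r.
Qed.

Lemma to_feedbackK : cancel to_feedback to_feedforward.
Proof.
move=> G; rewrite /to_feedforward {1}/to_feedback convNl opprK.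
by rewrite [conv (conv G _) _]convA -one_minus_to_feedback convA mul_geometric
  conv1r.
Qed.

End Controllers.

(** * Sparsity *)

Lemma submxblockM {R : pzSemiRingType} {p q r : nat} {p_ : 'I_p -> nat}
    {q_ : 'I_q -> nat} {r_ : 'I_r -> nat}
    (X : 'M[R]_(\sum_i p_ i, \sum_i q_ i))
    (Y : 'M[R]_(\sum_i q_ i, \sum_i r_ i)) i j :
  submxblock (X *m Y) i j = \sum_k submxblock X i k *m submxblock Y k j.
Proof.
by rewrite -{1}(submxblockK X) -{1}(submxblockK Y) mul_mxblock mxblockK.
Qed.

Section Sparsity.
Context {R : realType} {N : nat} (A : 'M[nat]_N).
Context (loops : forall i, A i i != 0%N).

(** Entries count walks: walks from [i] to [k] and from [k] to [j] concatenate, and no cancellation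
    occurs over [nat]. *)
Lemma expmx_eq0D (a b : nat) i j k :
  (A ^+ (a + b)) i j = 0%N -> (A ^+ a) i k = 0%N \/ (A ^+ b) k j = 0%N.
Proof.
rewrite exprD mxE => /eqP; rewrite sum_nat_eq0 => /forallP/(_ k).
by rewrite implyTb muln_eq0 => /orP[] /eqP; [left|right].
Qed.

(** The loop at [j] prolongs any walk ending there. *)
Lemma expmx_eq0_leq (a b : nat) i j :
  (a <= b)%N -> (A ^+ b) i j = 0%N -> (A ^+ a) i j = 0%N.
Proof.
move=> /subnKC <-; elim: (b - a)%N => [|k IH]; first by rewrite addn0.
rewrite addnS -addn1 => /(@expmx_eq0D _ _ _ _ j)[/IH//|/eqP].
by rewrite expr1 (negbTE (loops j)).
Qed.

Lemma sparseD {m_ n_ : 'I_N -> nat}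
    (f g : power_series R (\sum_i m_ i) (\sum_i n_ i)) :
  sparse_series A f -> sparse_series A g -> sparse_series A (f + g).
Proof. by move=> hf hg t i j t0; rewrite submxblockD hf// hg// addr0. Qed.

Lemma sparseN {m_ n_ : 'I_N -> nat}
    (f : power_series R (\sum_i m_ i) (\sum_i n_ i)) :
  sparse_series A f -> sparse_series A (- f).
Proof. by move=> hf t i j t0; rewrite submxblockN hf// oppr0. Qed.

Lemma sparse_conv {m_ n_ p_ : 'I_N -> nat}
    (f : power_series R (\sum_i m_ i) (\sum_i n_ i))
    (g : power_series R (\sum_i n_ i) (\sum_i p_ i)) :
  sparse_series A f -> sparse_series A g -> sparse_series A (conv f g).
Proof.
move=> hf hg t i j t0; rewrite submxblock_sum big1// => s _.
rewrite submxblockM big1// => k _.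
move: t0; rewrite -{1}(subnKC (leq_ord s)) => /(@expmx_eq0D _ _ _ _ k)[z|z].
  by rewrite hf// mul0mx.
by rewrite hg// mulmx0.
Qed.

(** Each coefficient moves up one degree, where the loops ensure that every block allowed before is
    still allowed. *)
Lemma sparse_shift {m_ n_ : 'I_N -> nat}
    (f : power_series R (\sum_i m_ i) (\sum_i n_ i)) :
  sparse_series A f -> sparse_series A (shift f).
Proof.
move=> hf [|t] i j t0; first exact: (submxblock0 i j).
by apply: hf; exact: expmx_eq0_leq t0.
Qed.

(** In degree 0 the pattern is that of the identity matrix. *)
Lemma sparse_const {m_ n_ : 'I_N -> nat}
    (M : 'M[R]_(\sum_i m_ i, \sum_i n_ i)) :
  block_diagonal M -> sparse_series A (const_series M).
Proof.
move=> hM [|t] i j t0; last exact: (submxblock0 i j).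
by apply: hM; apply: contra_eq_neq t0 => ->; rewrite expr0 mxE eqxx.
Qed.

Lemma sparse_one (n_ : 'I_N -> nat) :
  sparse_series A (one_series (R := R) (\sum_i n_ i)).
Proof.
by apply: sparse_const => i j /negbTE ij; rewrite -mxdiagZ mxblockK ij.
Qed.

(** The hypothesis bears on [shift Q] because a constant term such as [A] need not be block
    diagonal, whereas [lambda A] is sparse. *)
Lemma sparse_geometric {n_ : 'I_N -> nat}
    (Q : power_series R (\sum_i n_ i) (\sum_i n_ i)) :
  sparse_series A (shift Q) -> sparse_series A (geometric Q).
Proof.
move=> hQ t i j; rewrite /geometric.
suff iter_sparse k : sparse_series A
    (iter k (fun h => one_series (\sum_i n_ i) + shift (conv Q h)) 0).
  exact: iter_sparse.
elim: k => [|k IH]; first by move=> s i' j' _; exact: (submxblock0 i' j').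
by apply: sparseD; [exact: sparse_one|rewrite -conv_shiftl; exact: sparse_conv].
Qed.

End Sparsity.

(** * Both controller maps preserve sparsity *)

Section SparseControllers.
Context {R : realType} {N : nat} {n_ m_ : 'I_N -> nat}.
Context (A : 'M[R]_(\sum_i n_ i)) (B : 'M[R]_(\sum_i n_ i, \sum_i m_ i))
  (hB : block_diagonal B).

Lemma adjacency_loops i : adjacency A i i != 0%N.
Proof. by rewrite mxE eqxx. Qed.

(** [A] sits in degree 1, where the pattern is the adjacency matrix itself. *)
Lemma sparse_shift_const_adjacency :
  sparse_series (adjacency A) (shift (const_series A)).
Proof.
move=> [|[|t]] i j t0; try exact: (submxblock0 i j).
by move: t0; rewrite expr1 mxE; case: ifP => // /norP[_]; rewrite negbK => /eqP.
Qed.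

Lemma sparse_shift_const_conv (F : power_series R (\sum_i m_ i) (\sum_i n_ i)) :
  sparse_series (adjacency A) F ->
  sparse_series (adjacency A) (shift (conv (const_series B) F)).
Proof.
move=> hF; apply: (sparse_shift _ adjacency_loops).
by apply: sparse_conv => //; exact: sparse_const.
Qed.

Lemma sparse_to_feedforward (K : power_series R (\sum_i m_ i) (\sum_i n_ i)) :
  sparse_series (adjacency A) K ->
  sparse_series (adjacency A) (to_feedforward A B K).
Proof.
move=> hK; apply/sparseN/sparse_conv => //; apply: sparse_geometric.
rewrite shiftD; apply: sparseD; first exact: sparse_shift_const_adjacency.
exact: sparse_shift_const_conv.
Qed.

Lemma sparse_to_feedback (G : power_series R (\sum_i m_ i) (\sum_i n_ i)) :
  sparse_series (adjacency A) G ->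
  sparse_series (adjacency A) (to_feedback A B G).
Proof.
move=> hG; apply/sparseN/sparse_conv.
  apply: sparse_conv => //; apply: sparse_geometric.
  exact: sparse_shift_const_conv.
apply: sparseD; first exact: sparse_one.
exact/sparseN/sparse_shift_const_adjacency.
Qed.

End SparseControllers.

(** * Signals *)

Local Infix "**" := conv (at level 40, left associativity).

Section Signals.
Context {R : realType}.

(** The bridge from integer time to series: a signal vanishing at negative times is the series of
    its values, and a unit delay is multiplication by [lambda]. *)
Definition causal_ext {q} (f : nat -> 'cV[R]_q) : int -> 'cV[R]_q :=
  fun t => if t is Posz k then f k else 0.

Lemma causal_extE {q} (f : int -> 'cV[R]_q) t :
  (forall r, r < 0 -> f r = 0) -> f t = causal_ext (fun k => f k%:Z) t.
Proof. by case: t => [//|k] f0; rewrite f0. Qed.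

Lemma causal_ext_pred {q} (f : nat -> 'cV[R]_q) (t : int) :
  causal_ext f (t - 1) = causal_ext (shift f) t.
Proof.
case: t => [[|k]|k] //.
by have -> : k.+1%:Z - 1 = k%:Z by rewrite intS addrAC subrr add0r.
Qed.

Lemma causal_ext_subn {q} (f : nat -> 'cV[R]_q) (k j : nat) :
  causal_ext f (k%:Z - j%:Z) = if (j <= k)%N then f (k - j)%N else 0.
Proof.
case: leqP => [jk|kj]; first by rewrite subzn.
have : k%:Z - j%:Z < 0 by rewrite subr_lt0 ltz_nat.
by case: (k%:Z - j%:Z).
Qed.

(** Terms with [j > t] read the signal at negative times and vanish, so the partial sums are
    eventually constant. *)
Lemma series_conv {m n} (F : nat -> 'M[R]_(m, n)) (f : nat -> 'cV[R]_n)
    (t : int) (M : nat) :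
  (`|t| < M)%N ->
  series (fun j : nat => F j *m causal_ext f (t - j%:Z)) M =
  causal_ext (conv F f) t.
Proof.
case: t => [k|k] kM; rewrite /series/=; last first.
  by rewrite big1// => j _; rewrite NegzE -opprD/= mulmx0.
rewrite big_mkord /= /conv (big_ord_widen M (fun j => F j *m f (k - j)%N))//.
rewrite [RHS]big_mkcond/=.
by apply: eq_bigr => j _; rewrite causal_ext_subn ltnS;
  case: ifP; rewrite ?mulmx0.
Qed.

Lemma cvg_series_conv {m n} (F : nat -> 'M[R]_(m, n)) (f : nat -> 'cV[R]_n)
    (t : int) (l : 'cV[R]_m) :
  series (fun j : nat => F j *m causal_ext f (t - j%:Z)) @ \oo --> l <->
  l = causal_ext (conv F f) t.
Proof.
set u := series _; have cu : u @ \oo --> causal_ext (conv F f) t.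
  apply: cvg_near_cst; exists (`|t|.+1)%N => // M /= tM.
  exact: series_conv.
split=> [ul|->//].
exact: (cvg_unique (@norm_hausdorff _ _) ul cu).
Qed.

(** * Closed forms of the plant signals *)

Section Plant.
Context {T : Type} {n m p : nat} (A : 'M[R]_n) (B : 'M[R]_(n, m))
  (C : 'M[R]_(p, n)) (D : 'M[R]_(p, m)) (w : process R T n).
Context (w0 : forall (t : int) om, t < 0 -> w t om = 0).

Let W om : nat -> 'cV[R]_n := fun k => w k%:Z om.

Lemma disturbance_causal_ext om t : w t om = causal_ext (W om) t.
Proof. by apply: (causal_extE (w^~ om)) => r; exact: w0. Qed.

Definition series_signals (X : T -> nat -> 'cV[R]_n)
    (U : T -> nat -> 'cV[R]_m) :
    signals R T n m p :=
  Signals (fun t om => causal_ext (X om) t) (fun t om => causal_ext (U om) t)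
    (fun t om => C *m causal_ext (X om) t + D *m causal_ext (U om) t).

Lemma plant_series_signals X U :
  plant A B C D w (series_signals X U) <->
  forall om, X om = shift (conv (const_series A) (X om) +
                           conv (const_series B) (U om) + W om).
Proof.
split=> [[x0 xS _] om|XE].
  apply/funext => -[|k]; first exact: (x0 0 om).
  have := xS k%:Z om; rewrite [k%:Z + 1]addrC -intS/= => ->.
  by rewrite !series_addE !conv_const.
split=> [[[|k]|k] om //|t om|//]; first by rewrite /= XE.
(* At [t = -1] the plant yields the state at time 0, the zero constant term of a shifted series;
   before that everything is zero. *)
case: t => [k|[|k]].
- rewrite [k%:Z + 1]addrC -intS/= [in LHS]XE.
  by rewrite /= !series_addE !conv_const.
- by rewrite /= XE w0// !mulmx0 !addr0.
by rewrite /= w0// !mulmx0 !addr0.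
Qed.

Lemma plant_causal (s : signals R T n m p) :
  plant A B C D w s -> (forall om t, t < 0 -> control s t om = 0) ->
  s = series_signals (fun om k => state s k%:Z om)
                     (fun om k => control s k%:Z om).
Proof.
case: s => x u z [/= x0 _ zE] u0.
have xE : x = fun t om => causal_ext (fun k => x k%:Z om) t.
  apply/funext => t; apply/funext => om.
  by apply: (causal_extE (x^~ om)) => r /ltW/x0.
have uE : u = fun t om => causal_ext (fun k => u k%:Z om) t.
  apply/funext => t; apply/funext => om.
  by apply: (causal_extE (u^~ om)) => r /u0.
rewrite /series_signals -xE -uE; congr Signals.
by apply/funext => t; apply/funext => om; rewrite zE {1}xE {1}uE.
Qed.

(** [F] is a control law, outcome by outcome: convolution by [K] for feedback, independent of the
    state for feedforward. *)
Lemma plant_controlP (F : T -> (nat -> 'cV[R]_n) -> (nat -> 'cV[R]_m)) s :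
  (plant A B C D w s /\ forall t om,
     control s t om = causal_ext (F om (fun k => state s k%:Z om)) t) <->
  exists2 X, s = series_signals X (fun om => F om (X om)) &
    forall om, X om = shift (const_series A ** X om +
                             const_series B ** F om (X om) + W om).
Proof.
split=> [[ps uE]|[X -> XE]]; last by split=> //; exact/plant_series_signals.
pose X om k := state s k%:Z om.
have sE : s = series_signals X (fun om => F om (X om)).
  rewrite {1}(plant_causal _ ps) => [|om [//|k]]; last by rewrite uE.
  by congr series_signals; apply/funext => om; apply/funext => k; rewrite uE.
by exists X => //; apply/plant_series_signals; rewrite -sE.
Qed.

(** The state equation becomes [X = lambda (A + B K) X + lambda W], which [geometric_solve] solves
    uniquely. *)
Lemma feedbackP (K : power_series R m n) s :
  feedback_signals A B C D w K s <->
  s = series_signals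
        (fun om => geometric (closed_loop A B K) ** shift (W om))
        (fun om => K ** geometric (closed_loop A B K) ** shift (W om)).
Proof.
have X_solve om X : X = shift (const_series A ** X +
      const_series B ** (K ** X) + W om) <->
    X = geometric (closed_loop A B K) ** shift (W om).
  by rewrite -geometric_solve -convA -convDl shiftD.
have -> : feedback_signals A B C D w K s <->
    plant A B C D w s /\ forall t om,
      control s t om = causal_ext (K ** (fun k => state s k%:Z om)) t.
  have xE : plant A B C D w s -> forall t om,
      (fun j : nat => K j *m state s (t - j%:Z) om) =
      (fun j => K j *m causal_ext (fun k => state s k%:Z om) (t - j%:Z)).
    move=> [x0 _ _] t om; apply/funext => j.
    by rewrite [state _ _ _](causal_extE (state s ^~ om)) // => r /ltW/x0.
  by split=> -[ps us]; split=> // t om; move: (us t om);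
    rewrite (xE ps) => /cvg_series_conv.
rewrite (plant_controlP (fun=> conv K)); split=> [[X -> XE]|->].
  have -> : X = fun om => geometric (closed_loop A B K) ** shift (W om).
    by apply/funext => om; exact/X_solve.
  by congr series_signals; apply/funext => om; rewrite convA.
exists (fun om => geometric (closed_loop A B K) ** shift (W om)).
  by congr series_signals; apply/funext => om; rewrite convA.
by move=> om; exact/X_solve.
Qed.

(** The state equation becomes [X = lambda A X + (1 - lambda B G) lambda W]. The factor
    [1 - lambda B G] stays explicit so that [one_minus_to_feedforward] can rewrite it. *)
Lemma feedforwardP (G : power_series R m n) s :
  feedforward_signals A B C D w G s <->
  s = series_signals
        (fun om => geometric (const_series A) **
           one_minus_shift (const_series B ** G) ** shift (W om))
        (fun om => - (G ** shift (W om))).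
Proof.
have X_solve om X : X = shift (const_series A ** X +
      const_series B ** (- (G ** shift (W om))) + W om) <->
    X = geometric (const_series A) **
          one_minus_shift (const_series B ** G) ** shift (W om).
  rewrite convA -geometric_solve conv_one_minus_shift -addrA shiftD.
  by rewrite convNr [in X in shift _ + X]addrC shiftD shiftN convA.
have -> : feedforward_signals A B C D w G s <->
    plant A B C D w s /\ forall t om,
      control s t om = causal_ext (- (G ** shift (W om))) t.
  (* The extra unit delay in the disturbance turns [W] into [lambda W]. *)
  have wE om t : (fun j => G j *m w (t - 1 - j%:Z) om) =
      (fun j => G j *m causal_ext (shift (W om)) (t - j%:Z)).
    apply/funext => j; rewrite disturbance_causal_ext.
    by rewrite addrAC causal_ext_pred.
  have extN (f : nat -> 'cV[R]_m) t : causal_ext (- f) t = - causal_ext f t.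
    by case: t => // k; rewrite /= oppr0.
  split=> -[ps us]; split=> // t om.
    apply: oppr_inj; rewrite extN opprK; apply/cvg_series_conv; rewrite -wE.
    by rewrite -[series _]opprK; exact: cvgN (us t om).
  by rewrite us extN wE; apply: cvgN; apply/cvg_series_conv.
rewrite (plant_controlP (fun om _ => - (G ** shift (W om)))).
split=> [[X -> XE]|->].
  by congr series_signals; apply/funext => om; exact/X_solve.
by eexists; [reflexivity|move=> om; exact/X_solve].
Qed.

(** With [H] the inverse of [1 - lambda (A + B K)], the feedforward state is [(1 - lambda A)^-1 (1 -
    lambda A) H lambda W], that is, the feedback state [H lambda W]; both controls are
    [K H lambda W]. *)
Lemma feedback_feedforward (K : power_series R m n) s :
  feedback_signals A B C D w K s <->
  feedforward_signals A B C D w (to_feedforward A B K) s.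
Proof.
rewrite feedbackP feedforwardP one_minus_to_feedforward.
rewrite -[geometric _ ** (_ ** _)]convA geometric_mul conv1l.
suff -> : (fun om => - (to_feedforward A B K ** shift (W om))) =
  (fun om => K ** geometric (closed_loop A B K) ** shift (W om)) by [].
by apply/funext => om; rewrite convNl opprK.
Qed.

End Plant.
End Signals.

Theorem theorem3 (R : realType) (N : nat) (n_ m_ p_ : 'I_N -> nat)
    (hn : forall i, (1 <= n_ i)%N) (hm : forall i, (1 <= m_ i)%N)
    (A : 'M[R]_(\sum_i n_ i)) (B : 'M[R]_(\sum_i n_ i, \sum_i m_ i))
    (C : 'M[R]_(\sum_i p_ i, \sum_i n_ i))
    (D : 'M[R]_(\sum_i p_ i, \sum_i m_ i))
    (hB : block_diagonal B)
    (hBrank : forall i, \rank (submxblock B i i) = m_ i)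
    (d : measure_display) (T : measurableType d) (P : probability T R)
    (w : process R T (\sum_i n_ i)) (hw : disturbance P w) :
  let S := sparse_series (R := R) (m_ := m_) (n_ := n_) (adjacency A) in
  let feedback := feedback_signals A B C D w in
  let feedforward := feedforward_signals A B C D w in
  [/\ forall K, S K -> exists! s, feedback K s,
      forall G, S G -> exists! s, feedforward G s,
      exists Phi, set_bij S S Phi /\
        forall K, S K -> forall s s', feedback K s -> feedforward (Phi K) s' ->
          [/\ control s = control s', state s = state s', output s = output s'
            & cost P (output s) = cost P (output s')]
    & optimal_value P S feedback = optimal_value P S feedforward].
Proof.
move=> S feedback feedforward; have [w0 _ _] := hw.
pose Phi : power_series R (\sum_i m_ i) (\sum_i n_ i) -> _ :=
  to_feedforward A B.
have feedbackE K s : feedback K s <-> feedforward (Phi K) s.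
  exact: feedback_feedforward.
have SPhi K : S K -> S (Phi K) by exact: sparse_to_feedforward.
have SPsi G : S G -> S (to_feedback A B G) by exact: sparse_to_feedback.
split=> [K _|G _||].
(* The closed form gives existence and uniqueness at once. *)
- eexists; split; first exact/feedbackP.
  by move=> s /(feedbackP _ _ _ _ _ w0) ->.
- eexists; split; first exact/feedforwardP.
  by move=> s /(feedforwardP _ _ _ _ _ w0) ->.
- exists Phi; split.
    split=> [K /SPhi//|K K' _ _ /(can_inj (to_feedforwardK A B))//|G SG].
    by exists (to_feedback A B G); [exact: SPsi|exact: to_feedbackK].
  by move=> K _ s s' /feedbackE/(feedforwardP _ _ _ _ _ w0) ->
    /(feedforwardP _ _ _ _ _ w0) ->.
(* Both infima range over the same set of costs, since [Phi] and its inverse keep the signals and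
   preserve [S]. *)
- congr ereal_inf; apply/seteqP; split=> J /= [K [s [SK sK ->]]].
    by exists (Phi K), s; split; [exact: SPhi|exact/feedbackE|].
  exists (to_feedback A B K), s; split; [exact: SPsi| |by []].
  by apply/feedbackE; rewrite /Phi to_feedbackK.
Qed.
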